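(* No finite family of generalised chromatic polynomials is a complete graph invariant; that is, for every finite family of graphs $H_1,\dots,H_t$ there exist non-isomorphic graphs $G$ and $G'$ such that $\pi^{(H_i)}_G = \pi^{(H_i)}_{G'}$ (as functions of the number of colours $k$) for every $i\in\{1,\dots,t\}$.
   Context: All graphs are finite and simple. For a positive integer $k$, a $k$-colouring of a graph $G$ is a proper colouring $c\colon V(G)\to [k]=\{1,\dots,k\}$, i.e. $c(u)\neq c(v)$ whenever $uv\in E(G)$ (not all $k$ colours need be used). The $k$-colouring graph $\mathcal{C}_k(G)$ has as vertices the $k$-colourings of $G$, with an edge between two $k$-colourings if and only if they differ at precisely one vertex of $G$. For graphs $G$ and $H$, the generalised chromatic polynomial is the function $\pi^{(H)}_G$ where $\pi^{(H)}_G(k)$ is the number of subsets of $V(\mathcal{C}_k(G))$ that induce a subgraph of $\mathcal{C}_k(G)$ isomorphic to $H$. *)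

(* Defs.v *)
From mathcomp Require Import all_boot.

Set Implicit Arguments.
Unset Strict Implicit.
Unset Printing Implicit Defensive.

(* The vertex type may be empty, since a graph may have no k-colouring. *)
Record sgraph : Type := SGraph {
  vertex :> finType;
  edge : rel vertex;
  edge_sym : symmetric edge;
  edge_irrefl : irreflexive edge
}.

Definition isomorphic (G H : sgraph) : Prop :=
  exists2 f : G -> H, bijective f & forall x y : G, edge (f x) (f y) = edge x y.

(* Isomorphism is decidable as only finitely many pairs of mutually inverse
   maps have to be tried; the boolean form allows counting. *)
Definition isomorphicb (G H : sgraph) : bool :=
  [exists f : {ffun G -> H}, exists g : {ffun H -> G},
    [&& [forall x, g (f x) == x], [forall y, f (g y) == y]
      & [forall x, forall y, edge (f x) (f y) == edge x y]]].

Lemma isomorphicP (G H : sgraph) : reflect (isomorphic G H) (isomorphicb G H).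
Proof.
apply: (iffP existsP) => [[f /existsP[g /and3P[/forallP fK /forallP gK fE]]]|].
  exists f; first by exists g => x; apply/eqP.
  by move=> x y; apply/eqP; move/forallP: fE => /(_ x)/forallP/(_ y).
case=> f [g fK gK] fE; exists (finfun f); apply/existsP; exists (finfun g).
apply/and3P; split; apply/forallP => x; rewrite ?ffunE ?fK ?gK //.
by apply/forallP => y; rewrite !ffunE fE.
Qed.

Section Induced.
Variables (G : sgraph) (S : {set G}).

Definition induced_edge : rel {x : G | x \in S} :=
  fun x y => edge (val x) (val y).

Lemma induced_edge_sym : symmetric induced_edge.
Proof. by move=> x y; apply: edge_sym. Qed.

Lemma induced_edge_irrefl : irreflexive induced_edge.
Proof. by move=> x; apply: edge_irrefl. Qed.

Definition induced : sgraph := SGraph induced_edge_sym induced_edge_irrefl.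
End Induced.

Section ColouringGraph.
Variables (k : nat) (G : sgraph).

Definition proper_colouring (c : {ffun G -> 'I_k}) : bool :=
  [forall u, forall v, edge u v ==> (c u != c v)].

Definition colouring : finType := {c : {ffun G -> 'I_k} | proper_colouring c}.

Definition colouring_edge : rel colouring :=
  fun c d => #|[set v | val c v != val d v]| == 1.

Lemma colouring_edge_sym : symmetric colouring_edge.
Proof.
move=> c d; congr (_ == 1).
by apply: eq_card => v; rewrite !inE eq_sym.
Qed.

Lemma colouring_edge_irrefl : irreflexive colouring_edge.
Proof.
move=> c; rewrite /colouring_edge (_ : [set v | _] = set0) ?cards0 //.
by apply/setP => v; rewrite !inE eqxx.
Qed.

Definition colouring_graph : sgraph :=
  SGraph colouring_edge_sym colouring_edge_irrefl.
End ColouringGraph.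

Definition gen_chromatic (H G : sgraph) (k : nat) : nat :=
  #|[set S : {set colouring_graph k G} | isomorphicb (induced S) H]|.

(* Main.v *)
Require Import Defs.
From mathcomp Require Import all_boot perm.

Set Implicit Arguments.
Unset Strict Implicit.
Unset Printing Implicit Defensive.

(** Let [G] be the disjoint union of two paths of [n] vertices, where the first
    and the last edge of the second path are deleted, and [G'] the same union,
    where the first edge of the first path and the last edge of the second path
    are deleted. For an inner level [t], exchange the two rows of a colouring up
    to level [t], and exchange beyond level [t] the two colours seen at level
    [t]: this is an involution between the colourings of [G] and those of [G'].
    It preserves adjacency of [c] and [d] unless level [t] is the first one at
    which they differ. Each pair of colourings in a set [S] excludes at most one
    level, so if [n] is large compared with [#|S|] there is a least admissible
    level; applying the involution at this level is a bijection between the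
    sets of colourings, since the admissibility of the levels up to [t] is
    itself invariant under the involution at [t]. *)

(** * Isomorphisms of induced subgraphs *)

Lemma isomorphic_trans (G1 G2 G3 : sgraph) :
  isomorphic G1 G2 -> isomorphic G2 G3 -> isomorphic G1 G3.
Proof.
move=> [f fB fE] [g gB gE]; exists (g \o f); first exact: bij_comp.
by move=> x y /=; rewrite gE fE.
Qed.

(** Edge preservation is asked on [S] only, since a twist need not be an isomorphism of the whole
    colouring graphs. *)
Lemma induced_imset (G1 G2 : sgraph) (f : G1 -> G2) (g : G2 -> G1)
    (S : {set G1}) :
  cancel f g -> {in S &, forall x y, edge (f x) (f y) = edge x y} ->
  isomorphic (induced (f @: S)) (induced S).
Proof.
move=> fK fE.
have gS (y : induced (f @: S)) : g (val y) \in S.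
  by case: y => y /= /imsetP[x xS ->]; rewrite fK.
have fS (x : induced S) : f (val x) \in f @: S by apply: imset_f; apply: valP.
have gK (y : induced (f @: S)) : f (g (val y)) = val y.
  by case: y => y /= /imsetP[x xS ->]; rewrite fK.
exists (fun y => Sub (g (val y)) (gS y) : induced S).
  exists (fun x => Sub (f (val x)) (fS x) : induced (f @: S)) => x;
    by apply: val_inj; rewrite /= ?gK ?fK.
move=> x y; rewrite /= /induced_edge /= -[in RHS]gK -[in RHS](gK y).
by rewrite fE ?gS.
Qed.

Lemma isomorphic_induced_card (G H : sgraph) (S : {set G}) :
  isomorphic (induced S) H -> #|S| = #|H|.
Proof. by case=> f /bij_eq_card <- _; rewrite /= card_sig; apply: eq_card. Qed.

(** * The two graphs and their non-isomorphism *)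

Section TwoPaths.
Variable m : nat.
Local Notation V := ('I_m.+2 * bool)%type.

(** Only row [b] keeps its first edge and only row [true] its last one, so there is an intact path
    exactly when [b] is [true]. *)
Definition arc (b : bool) (x y : V) : bool :=
  [&& x.2 == y.2, y.1 == x.1.+1 :> nat, (x.1 == ord0) ==> (x.2 == b)
    & (y.1 == ord_max) ==> x.2].

Definition two_paths_edge (b : bool) : rel V :=
  fun x y => arc b x y || arc b y x.

Lemma two_paths_edge_sym b : symmetric (two_paths_edge b).
Proof. by move=> x y; rewrite /two_paths_edge orbC. Qed.

Lemma two_paths_edge_irrefl b : irreflexive (two_paths_edge b).
Proof.
by move=> x; rewrite /two_paths_edge orbb /arc (ltn_eqF (ltnSn _)) /= andbF.
Qed.

Definition two_paths (b : bool) : sgraph :=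
  SGraph (@two_paths_edge_sym b) (@two_paths_edge_irrefl b).

Lemma two_paths_edge_row b (x y : two_paths b) : edge x y -> x.2 = y.2.
Proof. by case/orP => /and4P[/eqP-> ]. Qed.

(** The intact path is connected, so its image lies in one row and by counting fills it; yet none of
    its vertices is isolated. *)
Lemma two_paths_nonisomorphic : ~ isomorphic (two_paths true) (two_paths false).
Proof.
move=> [f fB fE].
have succ (i j : 'I_m.+2) : j = i.+1 :> nat ->
    edge ((i, true) : two_paths true) ((j, true) : two_paths true).
  by move=> ij; rewrite /= /two_paths_edge /arc /= ij eqxx !implybT.
have row i : (f (i, true)).2 = (f (ord0, true)).2.
  case: i; elim=> [|i IH] lti; first by congr (f (_, _)).2; apply: val_inj.
  rewrite -(IH (ltnW lti)); apply/esym/two_paths_edge_row.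
  by rewrite fE; apply: succ.
have col_inj : injective (fun i => (f (i, true)).1).
  move=> i j /= ij.
  have /(bij_inj fB) [] // : f (i, true) = f (j, true).
  by apply: injective_projections; rewrite // !row.
have neighbour i : exists x : two_paths true, edge ((i, true) : two_paths true) x.
  case: (ltnP i m.+1) => im.
    by exists (Ordinal (im : i.+1 < m.+2), true); apply: succ.
  have pi : i.-1 < m.+2 by apply: leq_ltn_trans (leq_pred i) (ltn_ord i).
  exists (Ordinal pi, true); rewrite edge_sym; apply: succ.
  by rewrite /= prednK // (leq_trans _ im).
have [col' _ colK] := injF_bij col_inj.
(* Both rows of the second graph contain an isolated vertex. *)
pose b := (f (ord0, true)).2.
pose e : 'I_m.+2 := if b then ord0 else ord_max.
have fe : f (col' e, true) = (e, b).
  by apply: injective_projections; rewrite ?row //; apply: colK.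
have [x] := neighbour (col' e); rewrite -fE fe.
case: (f x) => j b'; rewrite /e; case: b {e fe}.
- by case/orP => /and4P[_ /eqP ji /implyP row0 _] //; move: (row0 (eqxx _)).
- case/orP => /and4P[/eqP /= b'E /eqP /= ji _ /implyP row_max].
    by have := ltn_ord j; rewrite ji ltnn.
  by move: (row_max (eqxx _)); rewrite b'E.
Qed.

(** * Twisting a colouring at a level *)

Section Twist.
Variable k : nat.
Implicit Types (c d : {ffun V -> 'I_k}) (s t : 'I_m.+2).

Definition twist t c : {ffun V -> 'I_k} :=
  [ffun v : V => if v.1 <= t then c (v.1, ~~ v.2)
             else tperm (c (t, true)) (c (t, false)) (c v)].

Lemma twistK t : involutive (twist t).
Proof.
move=> c; apply/ffunP => -[i b]; rewrite !ffunE /= leqnn /= negbK.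
by case: leqP => //= _; rewrite tpermC tpermK.
Qed.

(** First edges lie in the part with exchanged rows because [0 < t], last edges outside it because
    [t < m.+1]. An edge leaving level [t] stays proper because at that level exchanging the rows and
    exchanging the two colours have the same effect. *)
Lemma arc_twist b b' t c : b != b' -> 0 < t < m.+1 ->
  (forall x y, arc b x y -> c x != c y) ->
  forall x y, arc b' x y -> twist t c x != twist t c y.
Proof.
move=> bb' /andP[t0 tm] cP [i r] [j r'] /and4P[/= /eqP <- /eqP ji ir jr].
have b'E : b' = ~~ b by case: b b' bb' {cP ir} => [] [].
rewrite !ffunE /= ji; case: (ltnP i t) => [it|ti].
  rewrite ltnW //; apply: cP; rewrite /arc /= eqxx ji eqxx /=.
  apply/andP; split.
    apply/implyP => /(implyP ir) /eqP ->.
    by rewrite b'E negbK.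
  apply/implyP => /eqP jE; move: ji; rewrite jE /= => mi.
  by have := leq_ltn_trans it tm; rewrite -mi ltnn.
have cij : c (i, r) != c (j, r).
  apply: cP; rewrite /arc /= eqxx ji eqxx jr andbT /=.
  by apply/implyP => /eqP i0; move: ti; rewrite i0 leqNgt t0.
case: (ltngtP i t) ti => // [it _|/val_inj it _].
  by rewrite (inj_eq perm_inj).
have -> : c (i, ~~ r) = tperm (c (t, true)) (c (t, false)) (c (i, r)).
  by rewrite it; case: r {ir jr cij} => /=; rewrite ?tpermL ?tpermR.
by rewrite (inj_eq perm_inj).
Qed.

Lemma proper_two_pathsP b c :
  reflect (forall x y, arc b x y -> c x != c y)
          (proper_colouring (c : {ffun two_paths b -> 'I_k})).
Proof.
apply: (iffP forallP) => [cP x y xy | cP x].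
  have /forallP/(_ y)/implyP := cP x; apply.
  by rewrite /= /two_paths_edge xy.
apply/forallP => y; apply/implyP => /orP[/cP // | /cP].
by rewrite eq_sym.
Qed.

Definition agree s c d : bool := [forall b, c (s, b) == d (s, b)].

Lemma agreeP s c d : reflect (forall b, c (s, b) = d (s, b)) (agree s c d).
Proof. exact: eqfunP. Qed.

Lemma agree_twist s t c d : s <= t ->
  agree s (twist t c) (twist t d) = agree s c d.
Proof.
move=> st; apply/agreeP/agreeP => cd b.
  by have := cd (~~ b); rewrite !ffunE /= st negbK.
by rewrite !ffunE /= st cd.
Qed.

Definition split_at s c d : bool :=
  ~~ agree s c d && [forall r : 'I_m.+2, (r < s) ==> agree r c d].

Lemma split_at_twist s t c d : s <= t ->
  split_at s (twist t c) (twist t d) = split_at s c d.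
Proof.
move=> st; rewrite /split_at agree_twist //; congr (_ && _).
apply: eq_forallb => r; case: ltnP => //= rs.
by rewrite agree_twist // (leq_trans (ltnW rs)).
Qed.

Lemma split_at_inj s t c d : split_at s c d -> split_at t c d -> s = t.
Proof.
move=> /andP[ns /forallP ls] /andP[nt /forallP lt]; apply: val_inj => /=.
case: (ltngtP s t) => // st.
  by have := lt s; rewrite st (negPf ns).
by have := ls t; rewrite st (negPf nt).
Qed.

Definition diff c d : {set V} := [set v : V | c v != d v].

(** Agreement at [t] means that the same colour transposition acts on both colourings, so the set of
    differing vertices is merely moved by the row exchange [f]. *)
Lemma card_diff_twist t c d : agree t c d ->
  #|diff (twist t c) (twist t d)| = #|diff c d|.
Proof.
move=> /agreeP cd.
pose f (v : V) : V := if v.1 <= t then (v.1, ~~ v.2) else v.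
have fK : involutive f.
  by move=> [i b]; rewrite /f /=; case: (leqP i t) => it /=;
    rewrite ?it ?negbK // leqNgt it.
rewrite -[RHS](card_imset _ (inv_inj fK)); apply: eq_card => v.
rewrite -{2}[v]fK (mem_imset _ _ (inv_inj fK)) !inE !ffunE /f.
rewrite cd (cd false).
by case: leqP => //= _; rewrite (inj_eq perm_inj).
Qed.

Lemma card_diff_gt1 t c d : ~~ agree t c d -> ~~ split_at t c d ->
  #|diff c d| != 1.
Proof.
move=> nt; rewrite /split_at nt /= => /forallPn[r]; rewrite negb_imply.
case/andP => rt nr.
move: nt nr => /forallPn[b1 n1] /forallPn[b2 n2].
rewrite neq_ltn; apply/orP; right; apply/card_gt1P.
exists (t, b1), (r, b2); rewrite !inE; split=> //.
by apply/eqP => -[tr _]; rewrite tr ltnn in rt.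
Qed.

(** If [c] and [d] differ at [t], they also differ at an earlier level; this persists under the
    twist, so neither pair is adjacent. *)
Lemma diff_twist_edge t c d : ~~ split_at t c d ->
  (#|diff (twist t c) (twist t d)| == 1) = (#|diff c d| == 1).
Proof.
move=> ns; case: (boolP (agree t c d)) => [cd | ncd].
  by rewrite card_diff_twist.
rewrite (negPf (card_diff_gt1 ncd ns)); apply: negbTE.
by apply: (@card_diff_gt1 t); rewrite ?split_at_twist ?agree_twist.
Qed.

(** * The least admissible level of a set of colourings *)

Section Sets.
Variable b : bool.
Implicit Type S : {set colouring_graph k (two_paths b)}.

(* The last level is always admitted, as a junk value. *)
Definition admissible S t : bool :=
  (0 < t) && ((t < m.+1) ==>
    [forall c in S, forall d in S, ~~ split_at t (val c) (val d)]).

Definition first_level S : 'I_m.+2 := [arg min_(t < ord_max | admissible S t) t].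

Lemma first_levelP S : admissible S (first_level S) /\
  (forall t, admissible S t -> first_level S <= t).
Proof.
rewrite /first_level; case: arg_minnP => //.
by rewrite /admissible /= ltnn.
Qed.

(** Pigeonhole: if all [m] inner levels fail, choosing for each a pair split there injects them into
    the pairs from [S]. *)
Lemma first_level_lt S : #|S| ^ 2 < m -> 0 < first_level S < m.+1.
Proof.
move=> Sm; have [/andP[-> _] le_first] := first_levelP S.
rewrite ltnNge; apply/negP => first_max.
have bad (i : 'I_m) : exists p : {x | x \in S} * {x | x \in S},
    split_at (inord i.+1) (val (val p.1)) (val (val p.2)).
  have iE : (inord i.+1 : 'I_m.+2) = i.+1 :> nat.
    by rewrite inordK // !ltnS ltnW.
  have : ~~ admissible S (inord i.+1).
    apply/negP => /le_first; apply/negP; rewrite -ltnNge iE.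
    by apply: leq_trans first_max; rewrite ltnS.
  rewrite /admissible iE /= ltnS ltn_ord /= => /forall_inPn[c cS].
  case/forall_inPn => d dS; rewrite negbK => cd.
  by exists (Sub c cS, Sub d dS).
have [p pP] := fin_all_exists bad.
have p_inj : injective p.
  move=> i j ij; have := pP j; rewrite -ij => /(split_at_inj (pP i)).
  move/(congr1 val); rewrite /= !inordK ?ltnS 1?ltnW // => -[].
  exact: val_inj.
have := leq_card p p_inj; rewrite card_ord card_prod card_sig leqNgt.
by rewrite (@eq_card _ _ (mem S)) // mulnn Sm.
Qed.

End Sets.

(** * Transport of sets of colourings at a fixed level *)

Section Move.
Variables (t : 'I_m.+2) (t_inner : 0 < t < m.+1).

Lemma twist_proper b b' (c : colouring_graph k (two_paths b)) : b != b' ->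
  proper_colouring (twist t (val c) : {ffun two_paths b' -> 'I_k}).
Proof.
move=> bb'; apply/proper_two_pathsP; apply: arc_twist bb' t_inner _.
by apply/proper_two_pathsP; apply: valP.
Qed.

Definition twist_colouring b b' (bb' : b != b')
    (c : colouring_graph k (two_paths b)) : colouring_graph k (two_paths b') :=
  Sub (twist t (val c)) (twist_proper c bb').

Lemma twist_colouringK b b' (bb' : b != b') (b'b : b' != b) :
  cancel (twist_colouring bb') (twist_colouring b'b).
Proof. by move=> c; apply: val_inj; apply: twistK. Qed.

Lemma admissible_twist b b' (bb' : b != b')
    (S : {set colouring_graph k (two_paths b)}) s : s <= t ->
  admissible (twist_colouring bb' @: S) s = admissible S s.
Proof.
move=> st; congr (_ && (_ ==> _)).
apply/forall_inP/forall_inP => SP.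
  move=> c cS; apply/forall_inP => d dS.
  have /forall_inP/(_ _ (imset_f _ dS)) := SP _ (imset_f _ cS).
  by rewrite split_at_twist.
move=> _ /imsetP[c cS ->]; apply/forall_inP => _ /imsetP[d dS ->].
by rewrite split_at_twist //; have /forall_inP/(_ _ dS) := SP _ cS.
Qed.

(** The level can thus be recovered from the image, which keeps the move reversible although the
    level depends on the set. *)
Lemma first_level_twist b b' (bb' : b != b')
    (S : {set colouring_graph k (two_paths b)}) :
  first_level S = t -> first_level (twist_colouring bb' @: S) = t.
Proof.
move=> St; have [adm_t min_t] := first_levelP S; rewrite St in adm_t min_t.
have [adm_t' min_t'] := first_levelP (twist_colouring bb' @: S).
have le_t : first_level (twist_colouring bb' @: S) <= t.
  by apply: min_t'; rewrite admissible_twist.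
apply/val_inj/eqP; rewrite eqn_leq le_t min_t //.
by rewrite -(admissible_twist bb').
Qed.

Lemma twist_colouring_edge b b' (bb' : b != b')
    (S : {set colouring_graph k (two_paths b)}) : admissible S t ->
  {in S &, forall x y,
    edge (twist_colouring bb' x) (twist_colouring bb' y) = edge x y}.
Proof.
case/andP: t_inner => _ tm /andP[_]; rewrite tm => /forall_inP SP x y xS yS.
by apply: diff_twist_edge; have /forall_inP/(_ _ yS) := SP _ xS.
Qed.

Lemma leq_card_first_level (H : sgraph) b b' : b != b' ->
  #|[set S : {set colouring_graph k (two_paths b)} |
      isomorphicb (induced S) H & first_level S == t]| <=
  #|[set S : {set colouring_graph k (two_paths b')} |
      isomorphicb (induced S) H & first_level S == t]|.
Proof.
move=> bb'; have b'b : b' != b by rewrite eq_sym.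
have tK := twist_colouringK bb' b'b.
(* With [t] fixed, a single injective map moves all the sets, so taking images is injective. *)
rewrite -(card_imset _ (imset_inj (can_inj tK))).
apply: subset_leq_card; apply/subsetP => _ /imsetP[S + ->].
rewrite !inE => /andP[/isomorphicP SH /eqP St].
rewrite first_level_twist // eqxx andbT; apply/isomorphicP.
apply: isomorphic_trans SH; apply: induced_imset tK _.
by apply: twist_colouring_edge; rewrite -St; case: (first_levelP S).
Qed.

End Move.

Lemma gen_chromatic_first_level (H : sgraph) b :
  gen_chromatic H (two_paths b) k =
  \sum_t #|[set S : {set colouring_graph k (two_paths b)} |
             isomorphicb (induced S) H & first_level S == t]|.
Proof.
rewrite /gen_chromatic -sum1_card (partition_big (@first_level b) predT) //=.
by apply: eq_bigr => t _; rewrite -sum1_card; apply: eq_bigl => S; rewrite !inE.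
Qed.

Lemma leq_gen_chromatic (H : sgraph) b b' : #|H| ^ 2 < m -> b != b' ->
  gen_chromatic H (two_paths b) k <= gen_chromatic H (two_paths b') k.
Proof.
move=> Hm bb'; rewrite !gen_chromatic_first_level; apply: leq_sum => t _.
case: (boolP (0 < t < m.+1)) => [t_inner | t_outer].
  exact: leq_card_first_level.
(* Sets inducing [H] have [#|H|] elements, hence an inner first level. *)
rewrite (_ : [set S | _ & _] = set0) ?cards0 //.
apply/setP => S; rewrite !inE; apply/negP => /andP[/isomorphicP SH /eqP St].
move/negP: t_outer; apply; rewrite -St; apply: first_level_lt.
by rewrite (isomorphic_induced_card SH).
Qed.

End Twist.
End TwoPaths.

Theorem theorem5 (t : nat) (H : 'I_t -> sgraph) :
  exists G G' : sgraph,
    ~ isomorphic G G' /\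
    (forall (i : 'I_t) (k : nat), 0 < k ->
       gen_chromatic (H i) G k = gen_chromatic (H i) G' k).
Proof.
(* The successor gives the strict bound [#|H i| ^ 2 < m] that the pigeonhole argument needs. *)
pose m := (\max_i #|H i| ^ 2).+1.
exists (two_paths m true), (two_paths m false).
split; first exact: two_paths_nonisomorphic.
move=> i k _; apply/eqP; rewrite eqn_leq.
by rewrite !leq_gen_chromatic // ltnS (leq_bigmax (F := fun i => #|H i| ^ 2)).
Qed.
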